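(* Consider the two-level case $r=1$ of Algorithm RMNTR, and assume that the algorithm is called at the uppermost level with $\epsilon_r^h=0$. Then $$\liminf_{k\to\infty}h_{r,k}=0 .$$
   Context: If the algorithm terminates at level $r$ at some iteration $k$, use the convention $h_{r,\ell}=h_{r,k}$ for $\ell\ge k$. Problem and hierarchy. Levels $i=0,\dots,r$ with dimensions $n_0\le\dots\le n_r=n$. At level $i$ there is $F_i=f_i+\phi_i$ on $\mathbb{R}^{n_i}$; $F_r=F=f+\phi$ is the function to be minimized. Each $F_i$ satisfies: $\phi_i:\mathbb{R}^{n_i}\to(-\infty,\infty]$ is proper, closed, convex; $f_i$ is Fréchet differentiable with Lipschitz gradient on an open set containing $\operatorname{dom}\phi_i$; $F_i$ is bounded below on $\operatorname{dom}\phi_i$; the Hessian $\nabla^2f_i(x)$ (assumed to exist) and its self-adjoint approximation $B_i(x)$ satisfy $1+\max\{\|\nabla^2f_i(x)\|,\|B_i(x)\|\}\le\kappa_H$ for all $x$, with a constant $\kappa_H\ge1$. For $i\ge1$, the restriction $R_i^{i-1}\in\mathbb{R}^{n_{i-1}\times n_i}$ is full rank with $R_i^{i-1}(R_i^{i-1})^\top=I$, and the prolongation is $P_{i-1}^i=(R_i^{i-1})^\top$; hence the level norms $\|\cdot\|_i$ (with weight $M_r=I$, $M_i=(P_{r-1}^r\cdots P_i^{i+1})^\top(P_{r-1}^r\cdots P_i^{i+1})$) are Euclidean. Lower-level functions: $f_{i-1}(y)=f_i(y_1,\dots,y_{n_{i-1}},0,\dots,0)$, and, when level $i-1$ is called from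 $x_{i,k}$ with $x_{i-1,0}=R_i^{i-1}x_{i,k}$, $\phi_{i-1}(y)=\phi_i(x_{i,k}+(R_i^{i-1})^\top(y-x_{i-1,0}))$. The objective at level $r$ is $L_r=F_r$, and at level $i-1$ it is $$L_{i-1}(x_{i-1,0}+s)=F_{i-1}(x_{i-1,0}+s)+\langle R_i^{i-1}\nabla\tilde L_i(x_{i,k})-\nabla f_{i-1}(x_{i-1,0}),s\rangle,$$ where $\tilde L_i=L_i-\phi_i$ is the smooth part of $L_i$. With $t>0$ fixed, $h_{i,k}=\frac1t\|x_{i,k}-\operatorname{Prox}_{t\phi_i}(x_{i,k}-t\nabla\tilde L_i(x_{i,k}))\|_i$, where $\operatorname{Prox}_{t\phi}(y)=\arg\min_x\{\phi(x)+\frac1{2t}\|x-y\|^2\}$; in particular, $h_{i-1,0}$ uses $\nabla\tilde L_{i-1}(x_{i-1,0})=R_i^{i-1}\nabla\tilde L_i(x_{i,k})$. Algorithm RMNTR at level $i$, called with upper radius $\Delta_{i+1}$ (the radius $\Delta_{i+1,q}$ of the calling iteration; $\Delta_{r+1}=\infty$). Parameters: $0<\eta_1<\eta_2<1$, $0<\gamma_1\le\gamma_2<1\le\gamma_3$, $\kappa_{\rm stop}\in(0,1)$, $\Delta_i^s>0$, tolerances $\epsilon_i^h,\epsilon_i^\Delta\in(0,1)$ (except that here $\epsilon_r^h=0$). Start: $x_{i,0}\in\operatorname{dom}\phi_i$, $\Delta_{i,0}=\min\{\Delta_i^s,\Delta_{i+1}\}$, $k=0$. Step 1: if $i=0$,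 or if not both $h_{i-1,0}\ge\kappa_{\rm stop}h_{i,k}$ and $h_{i-1,0}\ge\epsilon_{i-1}^h$ hold (with $x_{i-1,0}=R_i^{i-1}x_{i,k}$), do Step 3; else Step 2. Step 2 (recursive): call the algorithm at level $i-1$ on $L_{i-1}$ from $x_{i-1,0}$ with upper radius $\Delta_{i,k}$; with its output $x_{i-1,*}$ put $s_{i,k}=P_{i-1}^i(x_{i-1,*}-x_{i-1,0})$ and $m_{i,k}(x_{i,k}+P_{i-1}^is_{i-1})=L_{i-1}(x_{i-1,0}+s_{i-1})$. Step 3 (Taylor): with $m_{i,k}(x_{i,k}+s)=\tilde L_i(x_{i,k})+\langle\nabla\tilde L_i(x_{i,k}),s\rangle+\frac12\langle B_{i,k}s,s\rangle+\phi_i(x_{i,k}+s)$, $B_{i,k}=B_i(x_{i,k})$, find a step $s_{i,k}$. Step 4: $\rho_{i,k}=\frac{L_i(x_{i,k})-L_i(x_{i,k}+s_{i,k})}{m_{i,k}(x_{i,k})-m_{i,k}(x_{i,k}+s_{i,k})}$; $x_{i,k+1}=x_{i,k}+s_{i,k}$ if $\rho_{i,k}\ge\eta_1$, else $x_{i,k+1}=x_{i,k}$. Step 5: if $h_{i,k}\le\epsilon_i^h$ or $\|x_{i,k+1}-x_{i,0}\|_i>(1-\epsilon_i^\Delta)\Delta_{i+1}$, return $x_{i,*}=x_{i,k+1}$. Step 6: choose $\Delta_{i,k}^+\in[\Delta_{i,k},\gamma_3\Delta_{i,k}]$ if $\rho_{i,k}\ge\eta_2$; $\in[\gamma_2\Delta_{i,k},\Delta_{i,k}]$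 if $\rho_{i,k}\in[\eta_1,\eta_2)$; $\in[\gamma_1\Delta_{i,k},\gamma_2\Delta_{i,k}]$ if $\rho_{i,k}<\eta_1$. Set $\Delta_{i,k+1}=\min\{\Delta_{i,k}^+,\Delta_{i+1}-\|x_{i,k+1}-x_{i,0}\|_i\}$, increase $k$ by 1, go to Step 1. Here $r=1$. Whichever model is chosen, the step is required to satisfy $\|s_{i,k}\|_i\le\Delta_{i,k}$ and the fraction of Cauchy decrease condition $m_{i,k}(x_{i,k})-m_{i,k}(x_{i,k}+s_{i,k})\ge\kappa_{\rm fcd}h_{i,k}\min\{h_{i,k}/(1+\|B_{i,k}\|_i),\Delta_{i,k}\}$, with $\kappa_{\rm fcd}=\frac12\min\{1,t_{\min}\kappa_{\rm stop}^2,\kappa_{\rm stop}^4/(\kappa_H-1)\}$ (last term $+\infty$ if $\kappa_H=1$), where $0<t_{\min}\le t\le t_{\max}<\infty$. *)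

(* Defs.v *)
From HB Require Import structures.
From mathcomp Require Import all_boot all_order all_algebra.
From mathcomp Require Import all_classical all_reals all_analysis.

Set Implicit Arguments.
Unset Strict Implicit.
Unset Printing Implicit Defensive.

Import Order.TTheory GRing.Theory Num.Theory.
Import numFieldNormedType.Exports.

Local Open Scope classical_set_scope.
Local Open Scope ring_scope.

(* The library norm `|x| on 'cV[R]_n is the sup norm; it has the same topology
   and the same differentials as enorm. *)
Definition dot (R : realType) n (u v : 'cV[R]_n) : R := \sum_i u i 0 * v i 0.

Definition enorm (R : realType) n (u : 'cV[R]_n) : R := Num.sqrt (dot u u).

Definition opnorm (R : realType) n (A : 'M[R]_n) : R :=
  sup [set enorm (A *m v) | v in [set v : 'cV[R]_n | enorm v <= 1]].

Definition grad (R : realType) n (f : 'cV[R]_n -> R) (x : 'cV[R]_n) : 'cV[R]_n :=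
  \col_i 'D_(delta_mx i 0) f x.

Definition hess (R : realType) n (f : 'cV[R]_n -> R) (x : 'cV[R]_n) : 'M[R]_n :=
  \matrix_(i, j) 'D_(delta_mx j 0) (fun y => grad f y i 0) x.

Definition dom (R : realType) n (phi : 'cV[R]_n -> \bar R) : set 'cV[R]_n :=
  [set x | (phi x < +oo)%E].

Definition proper_fun (R : realType) n (phi : 'cV[R]_n -> \bar R) : Prop :=
  (forall x, (-oo < phi x)%E) /\ exists x, dom phi x.

Definition econvex (R : realType) n (phi : 'cV[R]_n -> \bar R) : Prop :=
  forall (x y : 'cV[R]_n) (a : R), 0 <= a <= 1 ->
    (phi (a *: x + (1 - a) *: y)%R <= a%:E * phi x + (1 - a)%:E * phi y)%E.

(* For a proper function, closed means lower semicontinuous. *)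
Record level_assumptions (R : realType) n (f : 'cV[R]_n -> R)
    (phi : 'cV[R]_n -> \bar R) (B : 'cV[R]_n -> 'M[R]_n) (kH : R) : Prop :=
  LevelAssumptions {
    la_proper : proper_fun phi;
    la_closed : lower_semicontinuous phi;
    la_convex : econvex phi;
    la_bounded_below :
      exists c : R, forall x, dom phi x -> (c%:E <= (f x)%:E + phi x)%E;
    la_smooth : exists U : set 'cV[R]_n,
      [/\ open U, dom phi `<=` U,
          forall x, U x -> differentiable f x,
          exists C : R, 0 <= C /\ forall x y, U x -> U y ->
            enorm (grad f x - grad f y) <= C * enorm (x - y)
        & forall x, U x ->
            [/\ differentiable (grad f) x, (B x)^T = B x
              & 1 + Num.max (opnorm (hess f x)) (opnorm (B x)) <= kH]]
  }.

(* Under the standing assumptions the minimizer exists and is unique. *)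
Definition prox (R : realType) n (t : R) (phi : 'cV[R]_n -> \bar R)
    (y : 'cV[R]_n) : 'cV[R]_n :=
  get [set p | forall x,
    (phi p + ((2 * t)^-1 * enorm (p - y) ^+ 2)%:E
       <= phi x + ((2 * t)^-1 * enorm (x - y) ^+ 2)%:E)%E].

(* g stands for the gradient at x of the smooth part of the objective. *)
Definition crit (R : realType) n (t : R) (phi : 'cV[R]_n -> \bar R)
    (g x : 'cV[R]_n) : R :=
  t^-1 * enorm (x - prox t phi (x - t *: g)).

Record params (R : realType) := Params {
  eta1 : R; eta2 : R;
  gamma1 : R; gamma2 : R; gamma3 : R;
  kstop : R;
  kH : R;
  tmin : R; tmax : R; prox_t : R;
  eps_h0 : R;
  eps_D0 : R; eps_D1 : R;
  Delta_s0 : R; Delta_s1 : R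
}.

Record valid_params (R : realType) (p : params R) : Prop := ValidParams {
  vp_eta : [/\ 0 < eta1 p, eta1 p < eta2 p & eta2 p < 1];
  vp_gamma : [/\ 0 < gamma1 p, gamma1 p <= gamma2 p, gamma2 p < 1 & 1 <= gamma3 p];
  vp_kstop : 0 < kstop p < 1;
  vp_kH : 1 <= kH p;
  vp_t : [/\ 0 < tmin p, tmin p <= prox_t p & prox_t p <= tmax p];
  vp_eps_h0 : 0 < eps_h0 p < 1;
  vp_eps_D0 : 0 < eps_D0 p < 1;
  vp_eps_D1 : 0 < eps_D1 p < 1;
  vp_Delta_s0 : 0 < Delta_s0 p;
  vp_Delta_s1 : 0 < Delta_s1 p
}.

(* For kH = 1 the quotient kstop^4 / (kH - 1) is read as +oo, hence absent
   from the minimum. *)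
Definition kfcd (R : realType) (p : params R) : R :=
  let a := Num.min 1 (tmin p * kstop p ^+ 2) in
  2^-1 * (if kH p == 1 then a else Num.min a (kstop p ^+ 4 / (kH p - 1))).

(* The data with which the algorithm is called at one level: the objective
   L = smooth + nonsmooth, the map B_i, the tolerances eps_i^h and eps_i^Delta,
   Delta_i^s, the upper radius Delta_{i+1} (possibly +oo), and x_{i,0}. *)
Record call (R : realType) n := Call {
  smooth : 'cV[R]_n -> R;
  nonsmooth : 'cV[R]_n -> \bar R;
  hess_approx : 'cV[R]_n -> 'M[R]_n;
  tol_h : R;
  tol_D : R;
  rad_s : R;
  rad_upper : \bar R;
  start : 'cV[R]_n
}.

Definition objective (R : realType) n (c : call R n) (x : 'cV[R]_n) : \bar R :=
  ((smooth c x)%:E + nonsmooth c x)%E.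

Record trace (R : realType) n := Trace {
  iterate : nat -> 'cV[R]_n;
  step : nat -> 'cV[R]_n;
  radius : nat -> R
}.

Definition crit_at (R : realType) n (p : params R) (c : call R n)
    (x : 'cV[R]_n) : R :=
  crit (prox_t p) (nonsmooth c) (grad (smooth c) x) x.

(* The model at x, as a function of the step s: m(x + s). *)
Definition taylor_model (R : realType) n (c : call R n) (x s : 'cV[R]_n)
    : \bar R :=
  ((smooth c x + dot (grad (smooth c) x) s
     + 2^-1 * dot (hess_approx c x *m s) s)%:E + nonsmooth c (x + s)%R)%E.

(* fine is harmless here: the values involved are finite for every step
   admitted by admissible_step from a point of the domain. *)
Definition reduction_ratio (R : realType) n (c : call R n) (m : 'cV[R]_n -> \bar R)
    (x s : 'cV[R]_n) : R :=
  fine (objective c x - objective c (x + s)%R)%E / fine (m 0%R - m s)%E.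

(* A step with m(x + s) = +oo makes the left-hand side of the decrease
   condition -oo and is therefore rejected. *)
Definition admissible_step (R : realType) n (p : params R) (c : call R n)
    (m : 'cV[R]_n -> \bar R) (x s : 'cV[R]_n) (D : R) : Prop :=
  let h := crit_at p c x in
  enorm s <= D /\
  (m 0%R - m s
     >= (kfcd p * h * Num.min (h / (1 + opnorm (hess_approx c x))) D)%:E)%E.

Definition stops (R : realType) n (p : params R) (c : call R n)
    (tr : trace R n) (k : nat) : Prop :=
  crit_at p c (iterate tr k) <= tol_h c \/
  ((enorm (iterate tr k.+1 - start c))%:E > (1 - tol_D c)%:E * rad_upper c)%E.

Definition radius_update (R : realType) n (p : params R) (c : call R n)
    (rho D : R) (xnext : 'cV[R]_n) (Dnext : R) : Prop :=
  exists Dp : R,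
    [/\ eta2 p <= rho -> D <= Dp <= gamma3 p * D,
        eta1 p <= rho < eta2 p -> gamma2 p * D <= Dp <= D,
        rho < eta1 p -> gamma1 p * D <= Dp <= gamma2 p * D
      & Dnext%:E = mine Dp%:E (rad_upper c - (enorm (xnext - start c))%:E)%E].

Definition iteration (R : realType) n (p : params R) (c : call R n)
    (tr : trace R n) (k : nat) (m : 'cV[R]_n -> \bar R) : Prop :=
  let x := iterate tr k in
  let s := step tr k in
  let rho := reduction_ratio c m x s in
  [/\ admissible_step p c m x s (radius tr k),
      iterate tr k.+1 = (if eta1 p <= rho then x + s else x)
    & ~ stops p c tr k ->
      radius_update p c rho (radius tr k) (iterate tr k.+1) (radius tr k.+1)].

Definition starts (R : realType) n (c : call R n) (tr : trace R n) : Prop :=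
  iterate tr 0%N = start c /\ (radius tr 0%N)%:E = mine (rad_s c)%:E (rad_upper c).

(* Entries of the trace beyond the stopping iteration are irrelevant. *)
Definition taylor_run (R : realType) n (p : params R) (c : call R n)
    (tr : trace R n) : Prop :=
  starts c tr /\
  forall k, (forall j, (j < k)%N -> ~ stops p c tr j) ->
    iteration p c tr k (taylor_model c (iterate tr k)).

Definition returns (R : realType) n (p : params R) (c : call R n)
    (tr : trace R n) (y : 'cV[R]_n) : Prop :=
  exists k, [/\ stops p c tr k, forall j, (j < k)%N -> ~ stops p c tr j
              & y = iterate tr k.+1].

Record two_level (R : realType) n0 n1 := TwoLevel {
  f1 : 'cV[R]_n1 -> R;
  phi1 : 'cV[R]_n1 -> \bar R;
  B1 : 'cV[R]_n1 -> 'M[R]_n1;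
  B0 : 'cV[R]_n0 -> 'M[R]_n0;
  restr : 'M[R]_(n0, n1);
  x10 : 'cV[R]_n1
}.

(* pid_mx n0 : 'M_(n1, n0) pads a vector with zeros when n0 <= n1. *)
Definition f0 (R : realType) n0 n1 (P : two_level R n0 n1) (y : 'cV[R]_n0) : R :=
  f1 P ((pid_mx n0 : 'M[R]_(n1, n0)) *m y).

Definition phi0 (R : realType) n0 n1 (P : two_level R n0 n1) (x : 'cV[R]_n1)
    (y : 'cV[R]_n0) : \bar R :=
  phi1 P (x + (restr P)^T *m (y - restr P *m x)).

Definition top_call (R : realType) n0 n1 (p : params R) (P : two_level R n0 n1)
    : call R n1 :=
  Call (f1 P) (phi1 P) (B1 P) 0 (eps_D1 p) (Delta_s1 p) +oo%E (x10 P).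

(* The call of level 0 from the level-1 iterate x with level-1 radius D. *)
Definition coarse_call (R : realType) n0 n1 (p : params R) (P : two_level R n0 n1)
    (x : 'cV[R]_n1) (D : R) : call R n0 :=
  let x00 := restr P *m x in
  Call (fun y => f0 P y
          + dot (restr P *m grad (f1 P) x - grad (f0 P) x00) (y - x00))
       (phi0 P x) (B0 P) (eps_h0 p) (eps_D0 p) (Delta_s0 p) D%:E x00.

(* On s = restr^T *m s0 this is the coarse objective at x00 + s0, because
   restr *m restr^T = 1. *)
Definition coarse_model (R : realType) n0 n1 (c0 : call R n0)
    (P : two_level R n0 n1) (s : 'cV[R]_n1) : \bar R :=
  objective c0 (start c0 + restr P *m s).

Definition uses_coarse (R : realType) n0 n1 (p : params R) (P : two_level R n0 n1)
    (x : 'cV[R]_n1) : Prop :=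
  let h00 := crit (prox_t p) (phi0 P x) (restr P *m grad (f1 P) x) (restr P *m x) in
  kstop p * crit_at p (top_call p P) x <= h00 /\ eps_h0 p <= h00.

(* Iteration k of level 1 is executed: no earlier iteration stopped, and every
   earlier call of level 0 returned.  [coarse j] is the trace of the call made
   at iteration j, if any. *)
Definition reached (R : realType) n0 n1 (p : params R) (P : two_level R n0 n1)
    (tr : trace R n1) (coarse : nat -> trace R n0) (k : nat) : Prop :=
  forall j, (j < k)%N ->
    ~ stops p (top_call p P) tr j /\
    (uses_coarse p P (iterate tr j) ->
     exists y, returns p (coarse_call p P (iterate tr j) (radius tr j)) (coarse j) y).

(* Termination of the calls of level 0 is not built in: if such a call does not
   return, nothing is required of the level-1 trace from that iteration on. *)
Definition rmntr_run (R : realType) n0 n1 (p : params R) (P : two_level R n0 n1)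
    (tr : trace R n1) (coarse : nat -> trace R n0) : Prop :=
  let c1 := top_call p P in
  starts c1 tr /\
  forall k, reached p P tr coarse k ->
    let x := iterate tr k in
    let c0 := coarse_call p P x (radius tr k) in
    (~ uses_coarse p P x -> iteration p c1 tr k (taylor_model c1 x)) /\
    (uses_coarse p P x ->
      taylor_run p c0 (coarse k) /\
      forall y, returns p c0 (coarse k) y ->
        step tr k = (restr P)^T *m (y - start c0) /\
        iteration p c1 tr k (coarse_model c0 P)).

(* The index of the iteration that defines h_{1,l}: it stays at k once the
   algorithm has terminated at iteration k. *)
Fixpoint frozen_index (R : realType) n (p : params R) (c : call R n)
    (tr : trace R n) (l : nat) : nat :=
  if l is l'.+1 then
    let k := frozen_index p c tr l' in
    if `[< stops p c tr k >] then k else k.+1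
  else 0%N.

Definition hseq (R : realType) n (p : params R) (c : call R n)
    (tr : trace R n) (l : nat) : R :=
  crit_at p c (iterate tr (frozen_index p c tr l)).

(* Main.v *)
(* At both levels the model and the objective differ by at most 2 kappa_H |s|^2
   along a step s.  For the coarse model this constant has to be uniform in the
   iteration, so it is drawn from the Hessian bound, by two applications of the
   mean value theorem along the segment (which lies in the convex domain), and
   not from the Lipschitz constants of the gradients.  Hence steps with a small
   radius relative to the criticality measure are very successful.  If that
   measure stayed above some eps > 0, the radii would be bounded away from 0;
   as unsuccessful steps shrink the radius, there would be infinitely many
   successful ones, each lowering the objective by a fixed amount, against
   boundedness below.  At the coarse level, where eps is the tolerance and the
   linear correction is bounded on the trust region, this shows that every call
   returns; at the top level it gives the theorem. *)

Require Import Defs.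
From HB Require Import structures.
From mathcomp Require Import all_boot all_order all_algebra.
From mathcomp Require Import all_classical all_reals all_analysis.
From mathcomp Require Import ring lra.
Set Implicit Arguments.
Unset Strict Implicit.
Unset Printing Implicit Defensive.

Import Order.TTheory GRing.Theory Num.Theory.
Import numFieldNormedType.Exports.
Local Open Scope classical_set_scope.
Local Open Scope ring_scope.

(** * Euclidean inner product, norm and operator norm *)

Lemma dotC (R : realType) n (u v : 'cV[R]_n) : dot u v = dot v u.
Proof. by apply: eq_bigr => i _; rewrite mulrC. Qed.

Lemma dotDl (R : realType) n (u v w : 'cV[R]_n) :
  dot (u + v) w = dot u w + dot v w.
Proof. by rewrite -big_split; apply: eq_bigr => i _; rewrite mxE mulrDl. Qed.

Lemma dotZl (R : realType) n (a : R) (u w : 'cV[R]_n) :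
  dot (a *: u) w = a * dot u w.
Proof. by rewrite mulr_sumr; apply: eq_bigr => i _; rewrite mxE mulrA. Qed.

Lemma dotBl (R : realType) n (u v w : 'cV[R]_n) :
  dot (u - v) w = dot u w - dot v w.
Proof. by rewrite dotDl -scaleN1r dotZl mulN1r. Qed.

Lemma dotDr (R : realType) n (u v w : 'cV[R]_n) :
  dot u (v + w) = dot u v + dot u w.
Proof. by rewrite dotC dotDl !(dotC u). Qed.

Lemma dotZr (R : realType) n (a : R) (u w : 'cV[R]_n) :
  dot u (a *: w) = a * dot u w.
Proof. by rewrite dotC dotZl dotC. Qed.

Lemma dot0r (R : realType) n (u : 'cV[R]_n) : dot u 0 = 0.
Proof. by rewrite -[0](scale0r u) dotZr mul0r. Qed.

Lemma dotBr (R : realType) n (u v w : 'cV[R]_n) :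
  dot u (v - w) = dot u v - dot u w.
Proof. by rewrite dotC dotBl !(dotC u). Qed.

Lemma dot_mulmxl (R : realType) m n (A : 'M[R]_(m, n)) u v :
  dot (A *m u) v = dot u (A^T *m v).
Proof.
transitivity (\sum_i \sum_j A i j * u j 0 * v i 0).
  by apply: eq_bigr => i _; rewrite mxE mulr_suml.
rewrite exchange_big; apply: eq_bigr => j _; rewrite mxE mulr_sumr.
by apply: eq_bigr => i _; rewrite mxE mulrCA mulrA.
Qed.

Lemma dot_ge0 (R : realType) n (u : 'cV[R]_n) : 0 <= dot u u.
Proof. by apply: sumr_ge0 => i _; rewrite -expr2 sqr_ge0. Qed.

Lemma dot_eq0 (R : realType) n (u : 'cV[R]_n) : dot u u = 0 -> u = 0.
Proof.
move/eqP; rewrite psumr_eq0 => [/allP uu|i _]; last by rewrite -expr2 sqr_ge0.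
apply/colP => i; have := uu i (mem_index_enum _).
by rewrite mulf_eq0 orbb mxE => /eqP.
Qed.

Lemma enorm_ge0 (R : realType) n (u : 'cV[R]_n) : 0 <= enorm u.
Proof. exact: sqrtr_ge0. Qed.

Lemma enorm_sqr (R : realType) n (u : 'cV[R]_n) : enorm u ^+ 2 = dot u u.
Proof. by rewrite sqr_sqrtr ?dot_ge0. Qed.

Lemma enorm0 (R : realType) n : enorm (0 : 'cV[R]_n) = 0.
Proof. by rewrite /enorm dot0r sqrtr0. Qed.

Lemma enorm0_eq0 (R : realType) n (u : 'cV[R]_n) : enorm u = 0 -> u = 0.
Proof. by move=> u0; apply: dot_eq0; rewrite -enorm_sqr u0 expr0n. Qed.

Lemma enormZ (R : realType) n (a : R) (u : 'cV[R]_n) :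
  enorm (a *: u) = `|a| * enorm u.
Proof.
by rewrite /enorm dotZl dotZr mulrA -expr2 sqrtrM ?sqr_ge0// sqrtr_sqr.
Qed.

(** Cauchy-Schwarz, by expanding the squared norm of [dot v v *: u - dot u v *: v]. *)
Lemma dot_le_enorm (R : realType) n (u v : 'cV[R]_n) :
  `|dot u v| <= enorm u * enorm v.
Proof.
rewrite -(@ler_pXn2r _ 2) ?nnegrE ?mulr_ge0 ?enorm_ge0//.
rewrite real_normK ?num_real// exprMn !enorm_sqr.
have [v0|v_neq0] := eqVneq (dot v v) 0.
  by rewrite (dot_eq0 v0) !dot0r expr0n mulr0.
have vv : 0 < dot v v by rewrite lt_neqAle eq_sym v_neq0 dot_ge0.
have := dot_ge0 (dot v v *: u - dot u v *: v).
rewrite !(dotBl, dotBr, dotZl, dotZr) (dotC v u).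
rewrite (_ : _ - _ = dot v v * (dot u u * dot v v - dot u v ^+ 2)); last by ring.
by rewrite pmulr_rge0// subr_ge0.
Qed.

(** The Frobenius norm serves as [M], by Cauchy-Schwarz on each row. *)
Lemma enorm_mulmx_bounded (R : realType) n (A : 'M[R]_n) :
  exists M, forall v, enorm (A *m v) <= M * enorm v.
Proof.
pose S := \sum_i enorm (row i A)^T ^+ 2; exists (Num.sqrt S) => v.
have S0 : 0 <= S by apply: sumr_ge0 => i _; rewrite sqr_ge0.
rewrite -(@ler_pXn2r _ 2) ?nnegrE ?mulr_ge0 ?sqrtr_ge0 ?enorm_ge0//.
rewrite enorm_sqr exprMn sqr_sqrtr// mulr_suml; apply: ler_sum => i _.
have -> : (A *m v) i 0 = dot (row i A)^T v.
  by rewrite mxE; apply: eq_bigr => j _; rewrite !mxE.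
rewrite -expr2 -exprMn -(@real_normK _ (dot _ _)) ?num_real//.
by rewrite lerXn2r ?nnegrE ?mulr_ge0 ?enorm_ge0 ?dot_le_enorm.
Qed.

(** Without this bound the [sup] in [opnorm] could be a default value instead of a supremum. *)
Lemma opnorm_has_ubound (R : realType) n (A : 'M[R]_n) :
  has_ubound [set enorm (A *m v) | v in [set v : 'cV[R]_n | enorm v <= 1]].
Proof.
have [M AM] := enorm_mulmx_bounded A.
exists `|M| => _ [v /= v1 <-]; apply: le_trans (AM v) _.
apply: (@le_trans _ _ (`|M| * enorm v)); last by rewrite ler_piMr.
by rewrite ler_wpM2r ?enorm_ge0 ?ler_norm.
Qed.

Lemma enorm_mulmx_le (R : realType) n (A : 'M[R]_n) v :
  enorm (A *m v) <= opnorm A * enorm v.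
Proof.
have [v0|v_neq0] := eqVneq (enorm v) 0.
  by rewrite (enorm0_eq0 v0) mulmx0 enorm0 mulr0.
have v_gt0 : 0 < enorm v by rewrite lt_neqAle eq_sym v_neq0 enorm_ge0.
rewrite -ler_pdivrMr// mulrC -{1}[(enorm v)^-1]gtr0_norm ?invr_gt0//.
rewrite -enormZ scalemxAr; apply: ub_le_sup; first exact: opnorm_has_ubound.
by eexists => //=; rewrite enormZ gtr0_norm ?invr_gt0// mulVf.
Qed.

Lemma opnorm_ge0 (R : realType) n (A : 'M[R]_n) : 0 <= opnorm A.
Proof.
apply: (@le_trans _ _ (enorm (A *m 0))); first exact: enorm_ge0.
apply: ub_le_sup; first exact: opnorm_has_ubound.
by exists 0 => //=; rewrite enorm0.
Qed.

Lemma quadratic_form_le (R : realType) n (A : 'M[R]_n) (s : 'cV[R]_n) :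
  `|dot (A *m s) s| <= opnorm A * enorm s ^+ 2.
Proof.
apply: le_trans (dot_le_enorm _ _) _.
by rewrite expr2 mulrA ler_wpM2r ?enorm_ge0 ?enorm_mulmx_le.
Qed.

Lemma enorm_coisometry (R : realType) m n (A : 'M[R]_(m, n)) (w : 'cV[R]_m) :
  A *m A^T = 1%:M -> enorm (A^T *m w) = enorm w.
Proof. by move=> AA; rewrite /enorm dot_mulmxl trmxK mulmxA AA mul1mx. Qed.

(** * Derivatives along a segment and the first-order Taylor remainder *)

Lemma is_derive_line (R : realType) (V W : normedModType R) (f : V -> W)
    (x s : V) (tau : R) :
  derivable f (x + tau *: s) s ->
  is_derive tau 1 (fun u => f (x + u *: s)) ('D_s f (x + tau *: s)).
Proof.
move=> df.
have E : (fun h : R => h^-1 *: (f (x + (h *: (1 : R) + tau) *: s)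
                               - f (x + tau *: s)))
   = (fun h => h^-1 *: (f (h *: s + (x + tau *: s)) - f (x + tau *: s))).
  by apply/funext => h; rewrite scalerDl -[h *: 1]/(h * 1) mulr1 addrCA.
by split; rewrite /derivable /derive /= E.
Qed.

(** [grad] only collects partial derivatives; linearity of the differential on the standard basis
    gives the other directions. *)
Lemma derive_grad (R : realType) n (f : 'cV[R]_n -> R) (x v : 'cV[R]_n) :
  differentiable f x -> 'D_v f x = dot (grad f x) v.
Proof.
move=> df; rewrite deriveE//.
have -> : v = \sum_i v i 0 *: delta_mx i 0.
  apply/colP => i; rewrite summxE (bigD1 i)//= big1 => [|j ji].
    by rewrite !mxE !eqxx mulr1 addr0.
  by rewrite !mxE eq_sym (negbTE ji) mulr0.
rewrite raddf_sum/= /dot; apply: eq_bigr => i _.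
rewrite linearZ/= -deriveE// summxE [in RHS](bigD1 i)//= big1 => [|j ji].
  by rewrite !mxE !eqxx mulr1 addr0 mulrC.
by rewrite !mxE eq_sym (negbTE ji) mulr0.
Qed.

Lemma derivable_grad_coord (R : realType) n (f : 'cV[R]_n -> R) x i :
  differentiable (grad f) x -> differentiable (fun y => grad f y i 0) x.
Proof.
move=> df.
exact: (@differentiable_comp _ _ _ _ (grad f) (fun N : 'cV[R]_n => N i 0 : R) x
  df (differentiable_coord _ _ _)).
Qed.

Lemma derive_dot_grad (R : realType) n (f : 'cV[R]_n -> R) (x v w : 'cV[R]_n) :
  differentiable (grad f) x ->
  is_derive x v (fun y => dot (grad f y) w) (dot (hess f x *m v) w).
Proof.
move=> df.
have H i : is_derive x v (w i 0 *: (fun y => grad f y i 0))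
    (w i 0 *: (hess f x *m v) i 0).
  have dfi := derivable_grad_coord i df.
  have -> : (hess f x *m v) i 0 = 'D_v (fun y => grad f y i 0) x.
    rewrite derive_grad// mxE; apply: eq_bigr => j _.
    by rewrite !mxE.
  apply: is_deriveZ; apply: derivableP; exact: diff_derivable.
have := is_derive_sum H.
have -> : \sum_i (w i 0 *: (fun y => grad f y i 0)) = (fun y => dot (grad f y) w).
  by apply/funext => y; rewrite fct_sumE; apply: eq_bigr => i _; rewrite mulrC.
by have -> : \sum_i (w i 0 *: (hess f x *m v) i 0) = dot (hess f x *m v) w;
  first by apply: eq_bigr => i _; rewrite mulrC.
Qed.

Lemma MVT_line (R : realType) (V : normedModType R) (f : V -> R) (x s : V)
    (b : R) : 0 <= b ->
  (forall tau, 0 <= tau <= b -> derivable f (x + tau *: s) s) ->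
  exists2 c, 0 <= c <= b & f (x + b *: s) - f x = 'D_s f (x + c *: s) * b.
Proof.
move=> b0 df.
have [|| c + fb] := @MVT_segment R (fun u => f (x + u *: s))
    (fun u => 'D_s f (x + u *: s)) 0 b b0.
- move=> u; rewrite in_itv/= => /andP[u0 ub].
  by apply: is_derive_line; apply: df; rewrite !ltW.
- apply: derivable_within_continuous => u; rewrite in_itv/= => u01.
  by have [] := is_derive_line (df u u01).
rewrite in_itv/= => c0b; exists c => //.
by move: fb; rewrite scale0r addr0 subr0.
Qed.

(* The mean value theorem for f - <grad f x, .> along [s], and then for its
   derivative. *)
Lemma taylor1_bound (R : realType) n (f : 'cV[R]_n -> R) (x s : 'cV[R]_n) (K : R) :
  (forall tau, 0 <= tau <= 1 -> differentiable f (x + tau *: s)) ->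
  (forall tau, 0 <= tau <= 1 -> differentiable (grad f) (x + tau *: s)) ->
  (forall tau, 0 <= tau <= 1 -> opnorm (hess f (x + tau *: s)) <= K) ->
  `|f (x + s) - f x - dot (grad f x) s| <= K * enorm s ^+ 2.
Proof.
move=> df dg hK.
have [||c c01] := @MVT_line _ _ f x s 1 => //.
  by move=> tau t01; exact/diff_derivable/df.
have /andP[c0 c1] := c01.
have sub tau : 0 <= tau <= c -> 0 <= tau <= 1.
  by move=> /andP[-> /le_trans ->].
rewrite scale1r mulr1 => ->; rewrite derive_grad; last exact: df.
have [||d d0c] := @MVT_line _ _ (fun y => dot (grad f y) s) x s c => //.
  by move=> tau /sub t01; have [] := derive_dot_grad s s (dg _ t01).
move=> ->; have d01 := sub _ d0c.
rewrite (derive_val (is_derive := derive_dot_grad s s (dg _ d01))).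
rewrite normrM (ger0_norm c0).
(* The second mean value theorem runs over [[0, c]], which produces the factor [c <= 1] dropped
   here. *)
apply: (@le_trans _ _ (`|dot (hess f (x + d *: s) *m s) s|)).
  by rewrite ler_piMr.
apply: le_trans (quadratic_form_le _ _) _.
by rewrite ler_wpM2r ?sqr_ge0 ?hK.
Qed.

(** Meant for the linear correction in the coarse objective. *)
Lemma grad_add_linear (R : realType) n (f : 'cV[R]_n -> R) (v a x : 'cV[R]_n) :
  differentiable f x ->
  grad (fun y => f y + dot v (y - a)) x = grad f x + v.
Proof.
move=> df; apply/colP => i; rewrite !mxE.
have H : is_derive x (delta_mx i 0) (fun y => dot v (y - a)) (v i 0).
  have -> : (fun y => dot v (y - a)) = (fun y => \sum_j v j 0 * (y j 0 - a j 0)).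
    by apply/funext => y; apply: eq_bigr => j _; rewrite !mxE.
  have Hj j : is_derive x (delta_mx i 0) (v j 0 *: (fun y : 'cV[R]_n => y j 0 - a j 0))
      (v j 0 *: (delta_mx i 0 : 'cV[R]_n) j 0).
    apply: is_deriveZ; rewrite -[X in is_derive _ _ _ X]subr0.
    apply: is_deriveB.
    have dj := @differentiable_coord R n 1 x j 0.
    apply: DeriveDef; first exact: diff_derivable.
    apply: cvg_lim => //; apply: cvg_near_cst; near=> h => /=.
    rewrite !mxE addrK [_ *: _]mulrA mulVf ?mul1r//.
    by near: h; exact: nbhs_dnbhs_neq.
  have := is_derive_sum Hj.
  have -> : \sum_j (v j 0 *: (fun y : 'cV[R]_n => y j 0 - a j 0)) =
      (fun y => \sum_j v j 0 * (y j 0 - a j 0)).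
    by apply/funext => y; rewrite fct_sumE.
  rewrite (bigD1 i)//= big1 ?addr0 => [|j ji]; first by rewrite !mxE !eqxx [_ *: _]mulr1.
  by rewrite !mxE (negbTE ji) [_ *: _]mulr0.
have dfi : derivable f x (delta_mx i 0) by exact: diff_derivable.
by rewrite [LHS](deriveD dfi)// (derive_val (is_derive := H)).
Unshelve. all: by end_near. Qed.

(** * Consequences of the level assumptions on the domain *)

Lemma proper_fin_num {R : realType} {n} {phi : 'cV[R]_n -> \bar R} {x} :
  proper_fun phi -> dom phi x -> phi x = (fine (phi x))%:E.
Proof. by move=> [phiNy _] domx; rewrite fineK// fin_numE -ltNye phiNy -ltey. Qed.

Lemma dom_segment (R : realType) n (phi : 'cV[R]_n -> \bar R) x s (tau : R) :
  proper_fun phi -> econvex phi -> dom phi x -> dom phi (x + s) ->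
  0 <= tau <= 1 -> dom phi (x + tau *: s).
Proof.
move=> pr phi_conv domx domxs t01; rewrite /dom /=.
have -> : x + tau *: s = tau *: (x + s) + (1 - tau) *: x.
  by rewrite scalerDr scalerBl scale1r [RHS]addrC addrA subrK.
apply: le_lt_trans (phi_conv _ _ _ t01) _.
by rewrite (proper_fin_num pr domx) (proper_fin_num pr domxs) -!EFinM -EFinD ltry.
Qed.

(** The segment stays in the convex domain, where the Hessian norm is at most [kH - 1]; the constant
    therefore does not depend on the level or the iteration. *)
Lemma level_taylor1 (R : realType) n (f : 'cV[R]_n -> R) phi B (kH : R) x s :
  level_assumptions f phi B kH -> dom phi x -> dom phi (x + s) ->
  `|f (x + s) - f x - dot (grad f x) s| <= (kH - 1) * enorm s ^+ 2.
Proof.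
move=> [pr _ cv _ [U [_ domU df _ dg]]] domx domxs.
have inU tau : 0 <= tau <= 1 -> U (x + tau *: s).
  by move=> t01; apply/domU/dom_segment.
apply: taylor1_bound => tau /inU Ux; first exact: df.
- by have [] := dg _ Ux.
- have [_ _] := dg _ Ux; rewrite -lerBrDl; apply: le_trans.
  by rewrite le_max lexx.
Qed.

Lemma level_hess_approx (R : realType) n (f : 'cV[R]_n -> R) phi B (kH : R) x :
  level_assumptions f phi B kH -> dom phi x -> 1 + opnorm (B x) <= kH.
Proof.
move=> [_ _ _ _ [U [_ domU _ _ dg]]] /domU/dg[_ _]; apply: le_trans.
by rewrite lerD2l le_max lexx orbT.
Qed.

Lemma level_differentiable (R : realType) n (f : 'cV[R]_n -> R) phi B (kH : R) x :
  level_assumptions f phi B kH -> dom phi x -> differentiable f x.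
Proof. by move=> [_ _ _ _ [U [_ domU df _ _]]] /domU/df. Qed.

(** * Accuracy of the Taylor and coarse models *)

(** Actual against predicted decrease. The estimate is conditional on [m s < +oo], which every
    admissible step satisfies; finiteness then makes the two uses of [fine] faithful. *)
Definition accurate_model (R : realType) n (kH : R) (c : call R n)
    (m : 'cV[R]_n -> \bar R) (x s : 'cV[R]_n) : Prop :=
  m 0 \is a fin_num /\
  ((m s < +oo)%E ->
    [/\ m s \is a fin_num, dom (nonsmooth c) (x + s) &
      `|fine (objective c x - objective c (x + s)%R)%E - fine (m 0%R - m s)%E|
        <= 2 * kH * enorm s ^+ 2]).

(** The term in [v] is reproduced exactly by the model, so only the Taylor remainder of [f] and half
    the quadratic form of [B] are left. The vector [v] is 0 at the top level and the gradient
    correction at the coarse one. *)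
Lemma taylor_model_accurate (R : realType) n (f : 'cV[R]_n -> R) (v a : 'cV[R]_n)
    (c : call R n) (kH : R) x s : 1 <= kH ->
  smooth c = (fun y => f y + dot v (y - a)) ->
  level_assumptions f (nonsmooth c) (hess_approx c) kH ->
  dom (nonsmooth c) x -> accurate_model kH c (taylor_model c x) x s.
Proof.
move=> kH1 cE ok domx; have pr := la_proper ok.
split; first by rewrite /taylor_model addr0 (proper_fin_num pr domx).
rewrite {1}/taylor_model => ms.
have domxs : dom (nonsmooth c) (x + s).
  move: ms; have [phiNy _] := pr; have := phiNy (x + s).
  by rewrite /dom /=; case: (nonsmooth c (x + s)).
have ft := level_taylor1 ok domx domxs.
have Bq := quadratic_form_le (hess_approx c x) s.
have Bk := level_hess_approx ok domx.
have df := level_differentiable ok domx.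
rewrite /taylor_model /objective addr0 mulmx0 !dot0r.
rewrite (proper_fin_num pr domx) (proper_fin_num pr domxs) -?EFinD -?EFinB /=.
split=> //.
rewrite !cE grad_add_linear// (_ : x + s - a = (x - a) + s); last by rewrite addrAC.
rewrite dotDl !dotDr.
have e0 := sqr_ge0 (enorm s); have B0 := opnorm_ge0 (hess_approx c x).
move: ft Bq e0 Bk B0; set e := enorm s ^+ 2; set q := dot (_ *m s) s.
set b := opnorm _ => ft Bq e0 Bk B0.
have be : b * e <= (kH - 1) * e by rewrite ler_wpM2r// lerBrDl.
move: ft Bq; rewrite !ler_norml => /andP[ft1 ft2] /andP[Bq1 Bq2].
by apply/andP; split; lra.
Qed.

(** The nonsmooth parts coincide along [s], and the correction makes the first-order terms agree;
    what remains is the difference of the Taylor remainders of [f1] along [s] and [f0] along [w]. *)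
Lemma coarse_model_accurate (R : realType) n0 n1 (p : params R)
    (P : two_level R n0 n1) x (D kH : R) (w : 'cV[R]_n0) : 1 <= kH ->
  restr P *m (restr P)^T = 1%:M ->
  level_assumptions (f1 P) (phi1 P) (B1 P) kH ->
  level_assumptions (f0 P) (phi0 P x) (B0 P) kH ->
  dom (phi1 P) x ->
  accurate_model kH (top_call p P) (coarse_model (coarse_call p P x D) P) x
    ((restr P)^T *m w).
Proof.
move=> kH1 orth ok1 ok0 domx; have pr := la_proper ok1.
set s := _ *m w; set x0 := restr P *m x.
have Rs : restr P *m s = w by rewrite mulmxA orth mul1mx.
have phi0E y : phi0 P x (x0 + y) = phi1 P (x + (restr P)^T *m y).
  by rewrite /phi0 addrAC subrr add0r.
have m0 : coarse_model (coarse_call p P x D) P 0 = ((f0 P x0)%:E + phi1 P x)%E.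
  rewrite /coarse_model /objective/= -/x0 mulmx0 phi0E mulmx0 !addr0.
  by rewrite subrr dot0r addr0.
have ms : coarse_model (coarse_call p P x D) P s =
    ((f0 P (x0 + w) + dot (restr P *m grad (f1 P) x - grad (f0 P) x0) w)%:E
     + phi1 P (x + s)%R)%E.
  by rewrite /coarse_model /objective/= -/x0 Rs phi0E addrAC subrr add0r.
rewrite /accurate_model m0 ms; split; first by rewrite (proper_fin_num pr domx).
move=> ms_fin.
have domxs : dom (phi1 P) (x + s).
  move: ms_fin; have [phiNy _] := pr; have := phiNy (x + s).
  by rewrite /dom /=; case: (phi1 P (x + s)).
have dom0 : dom (phi0 P x) x0.
  by rewrite /dom /= -[x0]addr0 phi0E mulmx0 addr0.
have dom0w : dom (phi0 P x) (x0 + w) by rewrite /dom /= phi0E.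
have t1 := level_taylor1 ok1 domx domxs.
have t0 := level_taylor1 ok0 dom0 dom0w.
(* Prolongation is isometric, so both remainders are measured by the norm of [s]. *)
rewrite -(enorm_coisometry w orth) -/s in t0.
rewrite /objective /=.
rewrite (proper_fin_num pr domx) (proper_fin_num pr domxs) -?EFinD -?EFinB /=.
split=> //.
rewrite dotBl dot_mulmxl -/s.
have e0 := sqr_ge0 (enorm s).
have ke : (kH - 1) * enorm s ^+ 2 <= kH * enorm s ^+ 2.
  by rewrite ler_wpM2r// gerBl.
move: t0 t1; rewrite !ler_norml => /andP[t01 t02] /andP[t11 t12].
by apply/andP; split; lra.
Qed.

(** * The abstract trust-region argument on real sequences *)

Lemma kfcd_gt0 (R : realType) (p : params R) : valid_params p -> 0 < kfcd p.
Proof.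
move=> [_ _ /andP[ks0 _] kH1 [tmin0 _ _] _ _ _ _ _].
have a0 : 0 < Num.min 1 (tmin p * kstop p ^+ 2).
  by rewrite lt_min ltr01 mulr_gt0 ?exprn_gt0.
rewrite /kfcd mulr_gt0 ?invr_gt0//; case: eqP => // /eqP kHneq1.
by rewrite lt_min a0 divr_gt0 ?exprn_gt0// subr_gt0 lt_neqAle eq_sym kHneq1.
Qed.

(* The radii stay above [dmin], since every step of radius at most [delta] is
   very successful; hence there are infinitely many successful steps, each
   lowering [L] by at least [c * Num.min e dmin]. *)
Lemma trust_region_terminates (R : realType) (L D rho : nat -> R)
    (lo lo_ratio hi_ratio shrink1 shrink2 beta delta c e : R) :
  0 < shrink1 -> shrink2 < 1 -> 0 < beta -> 0 < delta -> 0 < c -> 0 < e ->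
  0 < D 0%N -> (forall k, lo <= L k) ->
  (forall k, lo_ratio <= rho k -> L k.+1 <= L k - c * Num.min e (D k)) ->
  (forall k, rho k < lo_ratio -> L k.+1 = L k /\ D k.+1 <= shrink2 * D k) ->
  (forall k, D k <= delta -> hi_ratio <= rho k) ->
  (forall k, hi_ratio <= rho k -> Num.min beta (D k) <= D k.+1) ->
  (forall k, Num.min beta (shrink1 * D k) <= D k.+1) -> False.
Proof.
move=> g10 g21 b0 d0 c0 e0 D0 loL succ fail small big any.
pose dmin := Num.min (D 0%N) (Num.min beta (shrink1 * delta)).
have dmin0 : 0 < dmin by rewrite !lt_min D0 b0 mulr_gt0.
have Dmin k : dmin <= D k.
  elim: k => [|k IH]; first by rewrite ge_min lexx.
  (* Up to [delta] the radius can only be cut by the cap [beta]; above [delta] one update loses at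
     most the factor [shrink1]. *)
  have [Dk|Dk] := leP (D k) delta.
    apply: le_trans (big _ (small _ Dk)).
    by rewrite le_min IH !ge_min lexx !orbT.
  apply: le_trans (any k); rewrite le_min !ge_min lexx !orbT/=.
  by rewrite ler_pM2l// (ltW Dk) !orbT.
pose sigma := c * Num.min e dmin.
have sigma0 : 0 < sigma by rewrite mulr_gt0// lt_min e0.
have succ_sigma k : lo_ratio <= rho k -> L k.+1 <= L k - sigma.
  move=> /succ/le_trans; apply; rewrite lerD2l lerN2 ler_pM2l//.
  rewrite le_min; apply/andP; split; first by rewrite ge_min lexx.
  by rewrite ge_min (Dmin k) orbT.
have next N : exists2 k, (N <= k)%N & lo_ratio <= rho k.
  apply: contrapT => no_succ.
  have failN k : (N <= k)%N -> rho k < lo_ratio.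
    move=> Nk; rewrite ltNge; apply/negP => rk; apply: no_succ.
    by exists k.
  (* Each failure removes a fraction [1 - shrink2] of a radius that is at least [dmin], so endless
     failure would drive [D] below [dmin]. *)
  have DN j : D (N + j)%N <= D N - j%:R * ((1 - shrink2) * dmin).
    elim: j => [|j IH]; first by rewrite addn0 mul0r subr0.
    rewrite addnS; have [_ /le_trans->//] := fail _ (failN (N + j)%N (leq_addr _ _)).
    have : (1 - shrink2) * dmin <= (1 - shrink2) * D (N + j)%N.
      by rewrite ler_pM2l ?subr_gt0.
    rewrite -natr1; move: IH; lra.
  have q0 : 0 < (1 - shrink2) * dmin by rewrite mulr_gt0 ?subr_gt0.
  have /(_ _) := @archi_boundP R (D N / ((1 - shrink2) * dmin)).
  set j := Num.bound _ => jP.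
  have DN0 : 0 <= D N / ((1 - shrink2) * dmin).
    by rewrite divr_ge0// ltW// (lt_le_trans dmin0).
  have := jP DN0; rewrite ltr_pdivrMr//.
  have := DN j; have := Dmin (N + j)%N; lra.
have mono k : L k.+1 <= L k.
  have [/succ_sigma /le_trans->//|/fail[->]//] := leP lo_ratio (rho k).
  by rewrite gerBl ltW.
have monoD N j : L (N + j)%N <= L N.
  elim: j => [|j IH]; first by rewrite addn0.
  by rewrite addnS (le_trans (mono _)).
(* Here [j] counts successful steps, not iterations. *)
have drop j : exists k, L k <= L 0%N - j%:R * sigma.
  elim: j => [|j [N LN]]; first by exists 0%N; rewrite mul0r subr0.
  have [k Nk rk] := next N; exists k.+1.
  have := succ_sigma k rk; have := monoD N (k - N)%N; rewrite subnKC//.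
  rewrite -natr1; move: LN; lra.
pose j := Num.bound ((L 0%N - lo) / sigma).
have [k Lk] := drop j.
have : (L 0%N - lo) / sigma < j%:R.
  by apply: archi_boundP; rewrite divr_ge0 ?(ltW sigma0)// subr_ge0.
rewrite ltr_pdivrMr//; have := loL k; move: Lk; lra.
Qed.

Lemma admissible_model_lty (R : realType) n (p : params R) (c : call R n) m x s D :
  m 0 \is a fin_num -> admissible_step p c m x s D -> (m s < +oo)%E.
Proof.
move=> m0 [_]; rewrite -(fineK m0); case: (m s) => [a _|/=|_].
- exact: ltry.
- by rewrite leNgt ltNyr.
- by [].
Qed.

(** * One iteration: decrease, acceptance and radius *)

Section Iteration.
Context {R : realType} {n : nat} {p : params R} (hp : valid_params p).
Context {c : call R n} {tr : trace R n} {k : nat} {m : 'cV[R]_n -> \bar R}.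
Hypothesis c_proper : proper_fun (nonsmooth c).
Hypothesis it : iteration p c tr k m.
Let x := iterate tr k.
Let s := step tr k.
Let D := Defs.radius tr k.
Hypothesis domx : dom (nonsmooth c) x.
Hypothesis acc : accurate_model (kH p) c m x s.
Let rho := reduction_ratio c m x s.

Lemma iteration_dom : dom (nonsmooth c) (iterate tr k.+1).
Proof.
have [adm -> _] := it; case: ifP => // _.
by have [m0 /(_ (admissible_model_lty m0 adm))[]] := acc.
Qed.

(** The predicted decrease is at least linear in a small [D], while the model error is at most
    [2 * kH p * D ^+ 2]; a small [D] thus brings the ratio close enough to 1. *)
Lemma iteration_success (eps : R) : 0 < D -> 0 < eps ->
  eps <= crit_at p c x -> 1 + opnorm (hess_approx c x) <= kH p ->
  (eta1 p <= rho ->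
    fine (objective c (iterate tr k.+1)) <= fine (objective c x)
      - eta1 p * (kfcd p * eps) * Num.min (eps / kH p) D) /\
  (D <= Num.min (eps / kH p) ((1 - eta2 p) * (kfcd p * eps) / (2 * kH p)) ->
    eta2 p <= rho).
Proof.
move=> D0 eps0 heps Bk.
have [adm xE _] := it; have [sD] := adm.
have [m0 /(_ (admissible_model_lty m0 adm))[ms domxs err]] := acc.
have kf0 := kfcd_gt0 hp; have kH1 := vp_kH hp.
have kH0 : 0 < kH p by rewrite (lt_le_trans _ kH1).
have B0 := opnorm_ge0 (hess_approx c x).
have [e1 e12 e21] := vp_eta hp.
have mfin : (m 0 - m s)%E \is a fin_num by rewrite fin_numB m0 ms.
rewrite -(fineK mfin) lee_fin.
move: err; rewrite /rho /reduction_ratio.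
set md := fine (m 0 - m s)%E; set od := fine (_ - _)%E.
move: (kfcd p) kf0 (crit_at p c x) heps => kf kf0 h heps err mdge.
(* The Cauchy decrease condition, with [h >= eps] and [1 + opnorm B <= kH] inserted. *)
have mdge' : kf * eps * Num.min (eps / kH p) D <= md.
  apply: le_trans mdge; rewrite -!mulrA ler_pM2l//.
  have h0 : 0 <= h by rewrite (le_trans (ltW eps0)).
  apply: ler_pM => //; first exact: ltW.
    by rewrite le_min (ltW D0) divr_ge0 ?(ltW eps0) ?(ltW kH0).
  rewrite le_min !ge_min lexx orbT andbT; apply/orP; left.
  apply: ler_pM; rewrite ?invr_ge0 ?(ltW eps0) ?(ltW kH0)//.
  by rewrite lef_pV2 ?posrE// ltr_pwDl.
have md0 : 0 < md.
  by apply: lt_le_trans mdge'; rewrite !mulr_gt0// lt_min D0 divr_gt0.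
have sDsq : enorm s ^+ 2 <= D ^+ 2 by rewrite lerXn2r ?nnegrE ?enorm_ge0// ltW.
have od_ge : md - 2 * kH p * D ^+ 2 <= od.
  move: err; rewrite ler_norml => /andP[err _].
  have : 2 * kH p * enorm s ^+ 2 <= 2 * kH p * D ^+ 2.
    by rewrite ler_wpM2l// mulr_ge0// ltW.
  move: err; lra.
split.
- rewrite ler_pdivlMr// => odmd.
  have -> : fine (objective c (iterate tr k.+1)) = fine (objective c x) - od.
    rewrite xE -/x -/s /reduction_ratio -/md -/od ler_pdivlMr// odmd /od /objective.
    rewrite (proper_fin_num c_proper domx) (proper_fin_num c_proper domxs).
    by rewrite -?EFinD -?EFinB /=; ring.
  rewrite lerD2l lerN2 -mulrA; apply: le_trans odmd.
  by rewrite ler_pM2l.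
- rewrite le_min => /andP[Deps Dsmall]; rewrite ler_pdivlMr//.
  (* It suffices that the error be at most [(1 - eta2 p) * md]; the second bound on [D] is this
     inequality with [md] replaced by [kf * eps * D] and one factor [D] cancelled. *)
  apply: le_trans od_ge; rewrite lerBrDr -lerBrDl.
  have -> : md - eta2 p * md = (1 - eta2 p) * md by ring.
  have mdD : kf * eps * D <= md.
    by apply: le_trans mdge'; rewrite ler_pM2l ?mulr_gt0// le_min Deps lexx.
  apply: (@le_trans _ _ ((1 - eta2 p) * (kf * eps * D))); last first.
    by rewrite ler_pM2l ?subr_gt0.
  move: Dsmall; rewrite ler_pdivlMr ?mulr_gt0// => Dsmall.
  rewrite (_ : _ * D ^+ 2 = D * (2 * kH p) * D); last by ring.
  by rewrite [leRHS]mulrA ler_pM2r.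
Qed.

(** [beta] bounds from below the room left inside the upper radius, so truncation by that radius
    never cuts below [beta]. *)
Lemma iteration_radius (beta : R) : 0 < D -> ~ stops p c tr k ->
  (beta%:E <= rad_upper c - (enorm (iterate tr k.+1 - start c))%:E)%E ->
  [/\ eta2 p <= rho -> Num.min beta D <= Defs.radius tr k.+1,
      rho < eta1 p -> Defs.radius tr k.+1 <= gamma2 p * D
    & Num.min beta (gamma1 p * D) <= Defs.radius tr k.+1].
Proof.
move=> D0 nstop betaP; have [_ _ /(_ nstop)[Dp [H2 H1 H0]]] := it.
rewrite -/x -/s -/rho -/D in H2 H1 H0 *.
have [g10 g12 g21 g3] := vp_gamma hp.
set up := (rad_upper c - _)%E in betaP * => DE.
have lower a : a <= Dp -> Num.min beta a <= Defs.radius tr k.+1.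
  move=> aDp; rewrite -lee_fin DE le_min !lee_fin; apply/andP; split.
    by rewrite ge_min aDp orbT.
  by apply: le_trans betaP; rewrite lee_fin ge_min lexx.
split.
- by move=> /H2/andP[DDp _]; exact: lower.
- move=> /H0/andP[_ Dpg]; apply: le_trans Dpg.
  by rewrite -lee_fin DE ge_min lexx.
- apply: lower.
  have g1D : gamma1 p * D <= gamma2 p * D by rewrite ler_pM2r.
  have g2D : gamma2 p * D <= D by rewrite ler_piMl// ltW.
  have [r1|r1] := ltP rho (eta1 p); first by have /andP[] := H0 r1.
  have [r2|r2] := ltP rho (eta2 p).
    have /H1 : eta1 p <= rho < eta2 p by rewrite r1 r2.
    by move=> /andP[+ _]; exact: le_trans.
  by have /andP[+ _] := H2 r2; apply: le_trans; exact: le_trans g2D.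
Qed.

End Iteration.

(** * Runs that never stop, and termination of the coarse calls *)

(** Otherwise the sequences shifted by [K] would contradict [trust_region_terminates]. The model may
    vary with [k], so that both levels are covered. *)
Lemma infinite_run_not_critical (R : realType) n (p : params R) (c : call R n)
    (tr : trace R n) (m : nat -> 'cV[R]_n -> \bar R) (K : nat) (lo eps beta : R) :
  valid_params p -> proper_fun (nonsmooth c) -> 0 < eps -> 0 < beta ->
  (forall k, iteration p c tr k (m k)) -> (forall k, ~ stops p c tr k) ->
  (forall k, dom (nonsmooth c) (iterate tr k)) -> (forall k, 0 < Defs.radius tr k) ->
  (forall k, accurate_model (kH p) c (m k) (iterate tr k) (step tr k)) ->
  (forall k, 1 + opnorm (hess_approx c (iterate tr k)) <= kH p) ->
  (forall k, lo <= fine (objective c (iterate tr k))) ->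
  (forall k,
    (beta%:E <= rad_upper c - (enorm (iterate tr k.+1 - start c))%:E)%E) ->
  exists2 k, (K <= k)%N & crit_at p c (iterate tr k) < eps.
Proof.
move=> hp pr eps0 beta0 it nstop domx D0 acc Bk loP betaP.
apply: contrapT => no_small.
have heps k : eps <= crit_at p c (iterate tr (K + k)).
  rewrite leNgt; apply/negP => small; apply: no_small.
  by exists (K + k)%N; rewrite ?leq_addr.
have [e1 e12 e21] := vp_eta hp.
have [g10 g12 g21 g3] := vp_gamma hp.
have kf0 := kfcd_gt0 hp.
have kH0 : 0 < kH p by rewrite (lt_le_trans _ (vp_kH hp)).
have kfe0 : 0 < kfcd p * eps by exact: mulr_gt0.
have S k := iteration_success hp pr (it _) (domx _) (acc _) (D0 (K + k)%N)
  eps0 (heps k) (Bk _).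
have Rad k := iteration_radius hp (it _) (D0 (K + k)%N) (nstop _) (betaP _).
apply: (@trust_region_terminates R (fun k => fine (objective c (iterate tr (K + k))))
  (fun k => Defs.radius tr (K + k))
  (fun k => reduction_ratio c (m (K + k)%N) (iterate tr (K + k)) (step tr (K + k)))
  lo (eta1 p) (eta2 p) (gamma1 p) (gamma2 p) beta
  (Num.min (eps / kH p) ((1 - eta2 p) * (kfcd p * eps) / (2 * kH p)))
  (eta1 p * (kfcd p * eps)) (eps / kH p)) => //.
- rewrite lt_min divr_gt0//= divr_gt0 ?(mulr_gt0 _ kH0)//.
  by apply: mulr_gt0; rewrite ?subr_gt0.
- exact: mulr_gt0.
- by rewrite divr_gt0.
- by move=> k r1; rewrite addnS; have [/(_ r1)] := S k.
- move=> k r1; rewrite addnS; split; last by have [_ /(_ r1)] := Rad k.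
  have [_ -> _] := it (K + k)%N.
  by rewrite leNgt r1.
- by move=> k /(proj2 (S k)).
- by move=> k r2; rewrite addnS; have [/(_ r2)] := Rad k.
- by move=> k; rewrite addnS; have [] := Rad k.
Qed.

Lemma crit_at_ge0 (R : realType) n (p : params R) (c : call R n) x :
  valid_params p -> 0 <= crit_at p c x.
Proof.
move=> /vp_t[t0 tt _]; rewrite /crit_at /crit mulr_ge0 ?enorm_ge0// invr_ge0.
by rewrite ltW// (lt_le_trans t0).
Qed.

Lemma objective_bounded_below (R : realType) n (f : 'cV[R]_n -> R) phi B kH :
  level_assumptions f phi B kH ->
  exists lo, forall x, dom phi x -> lo <= f x + fine (phi x).
Proof.
move=> ok; have [lo loP] := la_bounded_below ok; exists lo => x domx.
by have := loP _ domx; rewrite (proper_fin_num (la_proper ok) domx) lee_fin.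
Qed.

Lemma stops_returns (R : realType) n (p : params R) (c : call R n) tr :
  (exists k, stops p c tr k) -> exists y, returns p c tr y.
Proof.
move=> stop; have : exists k, `[< stops p c tr k >].
  by have [k sk] := stop; exists k; apply/asboolP.
case/ex_minnP => k /asboolP sk kmin; exists (iterate tr k.+1), k; split => // j jk sj.
by have := kmin j; rewrite leqNgt jk => /(_ (asboolT sj)).
Qed.

(** A run that never stops would keep its criticality above [eps_h0 p], which
    [infinite_run_not_critical] forbids. *)
Lemma coarse_call_returns (R : realType) n0 n1 (p : params R)
    (P : two_level R n0 n1) x D tr :
  valid_params p ->
  level_assumptions (f0 P) (phi0 P x) (B0 P) (kH p) ->
  dom (phi1 P) x -> 0 < D ->
  taylor_run p (coarse_call p P x D) tr ->
  exists y, returns p (coarse_call p P x D) tr y.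
Proof.
move=> hp ok domx D0 [[tr0 rad0] run]; apply: stops_returns.
apply: contrapT => nstop'; set c := coarse_call p P x D in nstop' rad0 run *.
have nstop k : ~ stops p c tr k by move=> sk; apply: nstop'; exists k.
have it k := run k (fun j _ => nstop j).
have pr : proper_fun (nonsmooth c) := la_proper ok.
have /andP[eD0 eD1] := vp_eps_D0 hp.
have near_start k : enorm (iterate tr k.+1 - start c) <= (1 - eps_D0 p) * D.
  by rewrite leNgt; apply/negP => far; apply: (nstop k); right.
(* As the distance test never fires, this much of the upper radius [D] always remains. *)
pose beta := eps_D0 p * D; have beta0 : 0 < beta by rewrite mulr_gt0.
have betaP k : (beta%:E <= rad_upper c - (enorm (iterate tr k.+1 - start c))%:E)%E.
  by rewrite -EFinB lee_fin; have := near_start k; rewrite /beta; lra.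
pose v := restr P *m grad (f1 P) x - grad (f0 P) (start c).
have acc k : dom (nonsmooth c) (iterate tr k) ->
    accurate_model (kH p) c (taylor_model c (iterate tr k)) (iterate tr k) (step tr k).
  exact: (@taylor_model_accurate R n0 (f0 P) v (start c) c (kH p) _ _
    (vp_kH hp) erefl ok).
have inv k : dom (nonsmooth c) (iterate tr k) /\ 0 < Defs.radius tr k.
  elim: k => [|k [domk Dk]].
    split; first by rewrite tr0 /dom /= /phi0 subrr mulmx0 addr0.
    by rewrite -lte_fin rad0 lt_min !lte_fin (vp_Delta_s0 hp) D0.
  split; first exact: iteration_dom (it k) domk (acc k domk).
  have [_ _] := iteration_radius hp (it k) Dk (nstop k) (betaP k).
  have [g10 _ _ _] := vp_gamma hp.
  by apply: lt_le_trans; rewrite lt_min beta0 mulr_gt0.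
have [lo loP] := objective_bounded_below ok.
have /andP[eh0 _] := vp_eps_h0 hp.
have in_ball k : enorm (iterate tr k - start c) <= D.
  case: k => [|k]; first by rewrite tr0 subrr enorm0 ltW.
  by apply: le_trans (near_start k) _; rewrite ler_piMl ?ltW// gtrBl.
(* All iterates lie within [D] of the start, so by Cauchy-Schwarz the linear correction lowers the
   bound [lo] by at most [enorm v * D]. *)
have [||||||k _] := @infinite_run_not_critical R _ p c tr
    (fun k => taylor_model c (iterate tr k)) 0 (lo - enorm v * D)
    (eps_h0 p) beta hp pr eh0 beta0 it nstop => //.
- by move=> k; have [] := inv k.
- by move=> k; have [] := inv k.
- by move=> k; apply: acc; have [] := inv k.
- by move=> k; have [domk _] := inv k; exact: level_hess_approx ok domk.
- move=> k; have [domk _] := inv k.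
  rewrite /objective (proper_fin_num pr domk) /= -/v.
  have := loP _ domk; have := dot_le_enorm v (iterate tr k - start c).
  rewrite ler_norml => /andP[+ _].
  have : enorm v * enorm (iterate tr k - start c) <= enorm v * D.
    by rewrite ler_wpM2l ?enorm_ge0.
  rewrite /c /=; lra.
- by move=> small; apply: (nstop k); left; exact: ltW.
Qed.

(** * The run at the top level *)

Section TopLevel.
Context {R : realType} {n0 n1 : nat} {p : params R} (hp : valid_params p).
Context {P : two_level R n0 n1} {tr : trace R n1} {coarse : nat -> trace R n0}.
Hypothesis restr_orth : restr P *m (restr P)^T = 1%:M.
Hypothesis top_ok : level_assumptions (f1 P) (phi1 P) (B1 P) (kH p).
Hypothesis x10_dom : dom (phi1 P) (x10 P).
Hypothesis run : rmntr_run p P tr coarse.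
Hypothesis coarse_ok : forall k, reached p P tr coarse k ->
  uses_coarse p P (iterate tr k) ->
  level_assumptions (f0 P) (phi0 P (iterate tr k)) (B0 P) (kH p).
Let c := top_call p P.

(** Merges the two kinds of iteration: later only the accuracy of the model matters. The first
    conjunct is what carries [reached] on to [k.+1]. *)
Lemma top_iteration k : reached p P tr coarse k ->
  dom (phi1 P) (iterate tr k) -> 0 < Defs.radius tr k ->
  (uses_coarse p P (iterate tr k) -> exists y,
    returns p (coarse_call p P (iterate tr k) (Defs.radius tr k)) (coarse k) y) /\
  exists m, iteration p c tr k m /\
    accurate_model (kH p) c m (iterate tr k) (step tr k).
Proof.
move=> reach domk Dk; have [_ /(_ k reach)[taylor rec]] := run.
have [use|nuse] := pselect (uses_coarse p P (iterate tr k)); last first.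
  split=> //; exists (taylor_model c (iterate tr k)); split; first exact: taylor.
  apply: (@taylor_model_accurate R n1 (f1 P) 0 0 c (kH p) _ _ (vp_kH hp) _ top_ok
    domk).
  by apply/funext => y; rewrite dotC dot0r addr0.
have [crun ret] := rec use.
have [y yret] := coarse_call_returns hp (coarse_ok reach use) domk Dk crun.
split=> [_|]; first by exists y.
have [stepE it] := ret y yret.
exists (coarse_model (coarse_call p P (iterate tr k) (Defs.radius tr k)) P).
split=> //; rewrite stepE.
exact: coarse_model_accurate (vp_kH hp) restr_orth top_ok (coarse_ok reach use) domk.
Qed.

Lemma top_not_critical (eps : R) K : (forall k, ~ stops p c tr k) -> 0 < eps ->
  exists2 k, (K <= k)%N & crit_at p c (iterate tr k) < eps.
Proof.
move=> nstop eps0; have [[tr0 rad0] _] := run.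
(* The upper radius is infinite, so any positive [beta] would do. *)
have betaP k : (1%:E <= rad_upper c - (enorm (iterate tr k.+1 - start c))%:E)%E.
  by rewrite addye ?leey.
(* A joint induction: the coarse call at [k] must return before [k.+1] is reached, and its
   termination needs the domain and the positive radius at [k]. *)
have inv k : [/\ reached p P tr coarse k, dom (phi1 P) (iterate tr k)
                & 0 < Defs.radius tr k].
  elim: k => [|k [reach domk Dk]].
    split; [by []|by rewrite tr0|].
    by rewrite -lte_fin rad0 lt_min !lte_fin (vp_Delta_s1 hp) ltry.
  have [ret [m [it acc]]] := top_iteration reach domk Dk.
  split.
  - move=> j; rewrite ltnS leq_eqVlt => /orP[/eqP->|]; first by split.
    exact: reach.
  - exact: iteration_dom it domk acc.
  - have [_ _] := iteration_radius hp it Dk (nstop k) (betaP k).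
    have [g10 _ _ _] := vp_gamma hp.
    by apply: lt_le_trans; rewrite lt_min ltr01 mulr_gt0.
have /choice[m mP] : forall k, exists m, iteration p c tr k m /\
    accurate_model (kH p) c m (iterate tr k) (step tr k).
  by move=> k; have [reach domk Dk] := inv k; have [_] := top_iteration reach domk Dk.
have [lo loP] := objective_bounded_below top_ok.
apply: (@infinite_run_not_critical R _ p c tr m K lo eps 1 hp (la_proper top_ok)
  eps0 ltr01) => //.
- by move=> k; have [] := mP k.
- by move=> k; have [] := inv k.
- by move=> k; have [] := inv k.
- by move=> k; have [] := mP k.
- by move=> k; have [_ domk _] := inv k; exact: level_hess_approx top_ok domk.
- move=> k; have [_ domk _] := inv k.
  by rewrite /objective /= (proper_fin_num (la_proper top_ok) domk) /= loP.
Qed.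

End TopLevel.

(** * The lower limit and the conclusion *)

(** Every tail infimum is already 0. *)
Lemma limn_einf_eq0 (R : realType) (u : nat -> R) :
  (forall k, 0 <= u k) ->
  (forall eps K, 0 < eps -> exists2 k, (K <= k)%N & u k < eps) ->
  limn_einf (fun k => (u k)%:E) = 0%E.
Proof.
move=> u0 small; rewrite limn_einf_lim.
rewrite (_ : einfs _ = cst 0%E); first exact: lim_cst.
apply/funext => K; apply/eqP; rewrite eq_le; apply/andP; split; last first.
  by apply: le_ereal_inf_tmp => _ [k _ <-]; rewrite lee_fin.
apply/lee_addgt0Pr => eps eps0; rewrite add0e.
have [k Kk uk] := small eps K eps0.
apply: (@le_trans _ _ (u k)%:E); last by rewrite lee_fin ltW.
by apply: ereal_inf_lbound; exists k.
Qed.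

Theorem corollary5p5 (R : realType) (n0 n1 : nat) (le_n01 : (n0 <= n1)%N)
    (p : params R) (hp : valid_params p)
    (P : two_level R n0 n1)
    (restr_free : row_free (restr P))
    (restr_orth : restr P *m (restr P)^T = 1%:M)
    (top_ok : level_assumptions (f1 P) (phi1 P) (B1 P) (kH p))
    (x10_dom : dom (phi1 P) (x10 P))
    (tr : trace R n1) (coarse : nat -> trace R n0)
    (run : rmntr_run p P tr coarse)
    (coarse_ok : forall k, reached p P tr coarse k ->
       uses_coarse p P (iterate tr k) ->
       level_assumptions (f0 P) (phi0 P (iterate tr k)) (B0 P) (kH p)) :
  limn_einf (fun k => (hseq p (top_call p P) tr k)%:E) = 0%E.
Proof.
set c := top_call p P.
apply: limn_einf_eq0 => [k|eps K eps0]; first exact: crit_at_ge0.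
have [[l stop]|nstop] := pselect (exists l, stops p c tr (frozen_index p c tr l)).
  have frozen j : frozen_index p c tr (j + l) = frozen_index p c tr l.
    by elim: j => //= j ->; case: asboolP.
  exists (K + l)%N; first exact: leq_addr.
  rewrite /hseq frozen; apply: le_lt_trans eps0.
  (* The criticality test has tolerance 0 and gives the claim at once; the distance test would need
     a real number above [+oo]. *)
  case: stop => // far; have := vp_eps_D1 hp => /andP[_ e1].
  by move: far; rewrite /= gt0_muley ?lte_fin ?subr_gt0.
(* Without a stop nothing freezes, and [hseq] is the criticality along the iterates. *)
have frozenE l : frozen_index p c tr l = l.
  elim: l => //= l IH; case: asboolP => [stop|_]; last by rewrite IH.
  by case: nstop; exists l.
have [|k Kk hk] := top_not_critical hp restr_orth top_ok x10_dom run coarse_ok K _ eps0.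
  by move=> l sl; apply: nstop; exists l; rewrite frozenE.
by exists k; [exact: Kk|rewrite /hseq frozenE].
Qed.
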